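(* Let $(X,Y)$ be a conditionally dependent (CD) random vector with function $s$, where $X$ has distribution $F$ and $Y$ has distribution $G$. Assume $F\in\mathscr R_{-\alpha}$ for some $\alpha\ge0$, with $\overline F(x)\sim x^{-\alpha}L(x)$ for a positive slowly varying function $L$, and $\overline G(x)=o(\overline F(x))$ as $x\to\infty$. Suppose that either (i) $\mathrm E\big(Y^{\alpha+\varepsilon}s(Y)\big)<\infty$ for some $\varepsilon>0$; or (ii) there exists a positive function $g$ on $[0,\infty)$ with $g(x)\downarrow0$, $xg(x)\uparrow\infty$ and $\overline G(xg(x))=o(\overline F(x))$, such that $\limsup_{x\to\infty}\sup_{1\le y\le xg(x)}L(x/y)/L(x)<\infty$, and $\mathrm E\big(Y^\alpha s(Y)\big)<\infty$. Then, with $H$ the distribution of $XY$, $$\overline H(x)=\mathrm P(XY>x)\sim\mathrm E\big(Y^\alpha s(Y)\big)\overline F(x),\qquad x\to\infty.$$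
   Context: $X$ is real-valued with distribution $F$ such that $\overline F(x)=1-F(x)>0$ for all $x\in\mathbb{R}$, and $Y$ takes values in $(0,\infty)$ with distribution $G$, $\overline G=1-G$. $D_Y=\{y\in(0,\infty):\mathrm P(Y\in(y-\delta,y+\delta))>0\ \forall\delta>0\}$. For $x\in\mathbb{R}$, $y\in D_Y$, $\mathrm P(X>x\mid Y=y)=\lim_{t\downarrow0}\mathrm P(X>x,Y\in[y,y+t))/\mathrm P(Y\in[y,y+t))$ when the limit exists. $(X,Y)$ is conditionally dependent (CD) with function $s$ if $s$ is a positive measurable function on $[0,\infty)$ such that these conditional tails exist and $\lim_{x\to\infty}\sup_{y\in D_Y}|\mathrm P(X>x\mid Y=y)/(\overline F(x)s(y))-1|=0$. $F\in\mathscr R_{-\alpha}$ (regularly varying tail with index $\alpha$) means $\overline F(xy)/\overline F(x)\to y^{-\alpha}$ as $x\to\infty$ for each $y>0$; $L$ is slowly varying if $L(xy)/L(x)\to1$ for each $y>0$. $a(x)\sim b(x)$ means $a(x)/b(x)\to1$ as $x\to\infty$. *)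

(* Defs.v *)
From HB Require Import structures.
From mathcomp Require Import all_boot all_order all_algebra.
From mathcomp Require Import all_classical all_reals all_analysis.
Set Implicit Arguments. Unset Strict Implicit. Unset Printing Implicit Defensive.
Import Order.TTheory GRing.Theory Num.Theory.
Import numFieldNormedType.Exports.
Local Open Scope classical_set_scope.
Local Open Scope ring_scope.

Section Defs.
Context (R : realType) (d : measure_display) (T : measurableType d)
  (P : probability T R).

Definition tailP (Z : T -> R) (x : R) : R := fine (P [set w | x < Z w]).

Definition DY (Y : T -> R) : set R :=
  [set y : R | 0 < y /\ forall delta : R, 0 < delta ->
     (0%:E < P [set w | (y - delta < Y w < y + delta)%R])%E].

Definition cond_ratio (X Y : T -> R) (x y t : R) : R :=
  fine (P [set w | x < X w /\ y <= Y w < y + t]) /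
  fine (P [set w | y <= Y w < y + t]).

Definition cond_tail_exists (X Y : T -> R) (x y : R) : Prop :=
  cvg (cond_ratio X Y x y t @[t --> 0^'+]).

(* P(X > x | Y = y), the value of that limit *)
Definition cond_tail (X Y : T -> R) (x y : R) : R :=
  lim (cond_ratio X Y x y t @[t --> 0^'+]).

Definition CD (X Y : T -> R) (s : R -> R) : Prop :=
  (forall y, 0 <= y -> 0 < s y) /\
  measurable_fun (`[0, +oo[%classic : set R) s /\
  (forall x y, DY Y y -> cond_tail_exists X Y x y) /\
  (forall e : R, 0 < e -> exists x0 : R, forall x, x0 < x ->
     forall y, DY Y y ->
       `| cond_tail X Y x y / (tailP X x * s y) - 1 | <= e).
End Defs.

Definition regvar_tail (R : realType) (Fbar : R -> R) (alpha : R) : Prop :=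
  forall y : R, 0 < y ->
    Fbar (x * y) / Fbar x @[x --> +oo] --> y `^ (- alpha).

Definition slowly_varying (R : realType) (L : R -> R) : Prop :=
  forall y : R, 0 < y -> L (x * y) / L x @[x --> +oo] --> (1 : R).

(* Main.v *)
Require Import Defs.
From HB Require Import structures.
From mathcomp Require Import all_boot all_order all_algebra.
From mathcomp Require Import all_classical all_reals all_analysis.
From mathcomp Require Import measurable_realfun ring lra.
Set Implicit Arguments.
Unset Strict Implicit.
Unset Printing Implicit Defensive.
Import Order.TTheory GRing.Theory Num.Theory.
Import numFieldNormedType.Exports.
Local Open Scope classical_set_scope.
Local Open Scope ring_scope.

(** The conditional tail P(X > x | Y = y) is a right derivative of the measure
    P(X > x, Y in .) with respect to the law of Y. Inequalities between right
    derivatives at every point integrate to inequalities between measures: after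
    inner and outer regularity this is a continuous induction along half-open
    intervals, and no differentiation theorem is needed. Write F for the tail of
    X. The right derivative of P(XY > x, Y in .) at y lies between
    (1 - e) F(x/y) s(y) and (1 + e) F(x/y) s(y) as soon as x/y is large, whence
    P(XY > x, Y <= c) ~ E(F(x/Y) s(Y); Y <= c) uniformly for x/c large.
    A truncation level c = h(x) at which P(Y > h(x)) = o(F(x)) is available in
    both cases: h(x) = x/c0 with Potter's bound, or h(x) = x g(x). Dominated
    convergence finishes the proof. *)

(** * Regularity of finite Borel measures on the line *)

Lemma cvg_measure_setD_bigsetU {d} {T : measurableType d} {R : realType}
    (mu : {finite_measure set T -> \bar R}) (U : set T) (C : (set T)^nat) :
  measurable U -> (forall n, measurable (C n)) ->
  mu (U `\` \big[setU/set0]_(i < n.+1) C i) @[n --> \oo] -->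
  mu (U `\` \bigcup_n C n).
Proof.
move=> mU mC.
have mUD n : measurable (U `\` \big[setU/set0]_(i < n.+1) C i).
  by apply: measurableD => //; exact: bigsetU_measurable.
have capE : \bigcap_n (U `\` \big[setU/set0]_(i < n.+1) C i) =
    U `\` \bigcup_n C n.
  rewrite bigcapIr; last by exists 0%N.
  by rewrite -setC_bigcup bigcup_bigsetU_bigcup.
rewrite -capE; apply: nonincreasing_cvg_mu => //.
- by rewrite ltey_eq fin_num_measure.
- exact: bigcapT_measurable.
- by move=> m n mn; apply/subsetPset; apply: setDS; exact: subset_bigsetU.
Qed.

Section closed_open_approximation.
Context {R : realType} (mu : {finite_measure set R -> \bar R}).
Implicit Types (A : set R) (e : R).

Definition closed_open_approx A e : Prop :=
  exists C U : set R, [/\ closed C, open U, C `<=` A, A `<=` U &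
    (mu (U `\` C) < e%:E)%E].

Lemma closed_open_approx_bigcup_closed (A U : set R) (C : (set R)^nat) e :
  (forall n, closed (C n)) -> open U -> \bigcup_n C n `<=` A -> A `<=` U ->
  (mu (U `\` \bigcup_n C n) < e%:E)%E -> closed_open_approx A e.
Proof.
move=> cC oU CA AU mue.
have mC n : measurable (C n) by exact: closed_measurable.
have /(_ _ (open_ereal_lt' mue))[n _ /(_ n (leqnn n)) mune] :=
  cvg_measure_setD_bigsetU (mu := mu) (open_measurable oU) mC.
exists (\big[setU/set0]_(i < n.+1) C i), U; split => //.
- by apply: closed_bigsetU => i _; exact: cC.
- by apply: subset_trans CA; exact: bigsetU_bigcup.
Qed.

Lemma closed_open_approx_itvoy x e : 0 < e ->
  closed_open_approx `]x, +oo[%classic e.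
Proof.
move=> e0.
apply: (@closed_open_approx_bigcup_closed _ `]x, +oo[%classic
  (fun n => `[x + n.+1%:R^-1, +oo[%classic)) => //.
- by move=> n; exact: interval_closed.
- by rewrite -itvoyEbigcup.
- by rewrite -itvoyEbigcup setDv measure0 lte_fin.
Qed.

Lemma closed_open_approxC A e :
  closed_open_approx A e -> closed_open_approx (~` A) e.
Proof.
move=> [C [U [cC oU CA AU muUC]]]; exists (~` U), (~` C); split.
- by rewrite closedC.
- by rewrite openC.
- exact: subsetC.
- exact: subsetC.
- by rewrite setDE setCK setIC -setDE.
Qed.

Lemma closed_open_approx_bigcup (A : (set R)^nat) :
  (forall n e, 0 < e -> closed_open_approx (A n) e) ->
  forall e, 0 < e -> closed_open_approx (\bigcup_n A n) e.
Proof.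
move=> approxA e e0.
pose r n : R := (e / 2) / (2 ^ n.+1)%:R.
have r0 n : 0 < r n by rewrite !divr_gt0// ltr0n expn_gt0.
have /choice[C] : forall n, exists C U : set R, [/\ closed C, open U,
    C `<=` A n, A n `<=` U & (mu (U `\` C) < (r n)%:E)%E].
  by move=> n; exact: approxA.
move=> /choice[U CU].
have mC n : measurable (C n) by apply: closed_measurable; have [] := CU n.
have mU n : measurable (U n) by apply: open_measurable; have [] := CU n.
have mUC : measurable (\bigcup_n U n `\` \bigcup_n C n).
  by apply: measurableD; exact: bigcupT_measurable.
apply: (@closed_open_approx_bigcup_closed _ (\bigcup_n U n) C).
- by move=> n; have [] := CU n.
- by apply: bigcup_open => n _; have [] := CU n.
- by apply: subset_bigcup => n _; have [] := CU n.
- by apply: subset_bigcup => n _; have [] := CU n.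
apply: (@le_lt_trans _ _ (e / 2)%:E); last by rewrite lte_fin; lra.
apply: (@le_trans _ _ (\sum_(n <oo) mu (U n `\` C n))%E).
  apply: measure_sigma_subadditive => // [n|y [[n _ Uny] nCy]].
    exact: measurableD.
  by exists n => //; split => // Cny; apply: nCy; exists n.
apply: (le_trans _ (@epsilon_trick0 R (e / 2) xpredT _)); last by lra.
by apply: lee_nneseries => // n _; apply/ltW; have [] := CU n.
Qed.

Lemma measurable_closed_open_approx A e : measurable A -> 0 < e ->
  closed_open_approx A e.
Proof.
move=> mA e0; move: A mA e e0.
suff : measurable `<=` [set A | forall e, 0 < e -> closed_open_approx A e].
  by [].
rewrite [X in X `<=` _](@RGenOInfty.measurableE R).
apply: smallest_sub; last by move=> _ [x ->] e; exact: closed_open_approx_itvoy.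
split => [e e0|A approxA e e0|A]; last exact: closed_open_approx_bigcup.
- exists set0, set0; split => //; first exact: closed0.
  by rewrite setD0 measure0 lte_fin.
- by rewrite setTD; exact/closed_open_approxC/approxA.
Qed.

Lemma closed_inner_approx A e : measurable A -> 0 < e ->
  exists C : set R, [/\ closed C, C `<=` A & (mu A <= mu C + e%:E)%E].
Proof.
move=> mA e0.
have [C [U [cC oU CA AU muUC]]] := measurable_closed_open_approx mA e0.
have mC := closed_measurable cC; have mU := open_measurable oU.
exists C; split => //.
rewrite (measureDI mu mA mC) (setIidr CA) addeC leeD2l//.
apply/ltW; apply: le_lt_trans muUC; apply: le_measure; rewrite ?inE.
- exact: measurableD.
- exact: measurableD.
- exact: setSD.
Qed.

Lemma open_outer_approx A e : measurable A -> 0 < e ->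
  exists U : set R, [/\ open U, A `<=` U & (mu U <= mu A + e%:E)%E].
Proof.
move=> mA e0.
have [C [U [cC oU CA AU muUC]]] := measurable_closed_open_approx mA e0.
have mC := closed_measurable cC; have mU := open_measurable oU.
exists U; split => //.
rewrite (measureDI mu mU mA) (setIidr AU) addeC leeD2l//.
apply/ltW; apply: le_lt_trans muUC; apply: le_measure; rewrite ?inE.
- exact: measurableD.
- exact: measurableD.
- exact: setDS.
Qed.

End closed_open_approximation.

(** * Comparison of measures through their right derivatives *)

Lemma real_induction {R : realType} (Q : R -> Prop) (a b : R) : a <= b ->
  (forall c, a <= c <= b -> (forall t, a <= t < c -> Q t) -> Q c) ->
  (forall c, a <= c < b -> Q c -> \forall t \near c^'+, Q t) -> Q b.
Proof.
move=> ab Qsup Qright.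
pose S : set R := [set c | a <= c <= b /\ forall t, a <= t <= c -> Q t].
have Qa : Q a by apply: Qsup => [|t]; lra.
have Sa : S a.
  split=> [|t]; first by rewrite lexx.
  by rewrite -eq_le => /eqP <-.
have supS : has_sup S by split; [exists a|exists b => t [/andP[]]].
have ac : a <= sup S by exact: (sup_ubound supS.2).
have cb : sup S <= b by apply: ge_sup => //; [exists a|move=> t [/andP[]]].
have Qlt t : a <= t < sup S -> Q t.
  move=> /andP[at_ tc].
  have ct0 : 0 < sup S - t by rewrite subr_gt0.
  have [u [_ Qu] tu] := sup_adherent ct0 supS.
  by apply: Qu; lra.
have Qc : Q (sup S) by apply: Qsup => //; rewrite ac.
have [cltb|bc] := ltP (sup S) b; last by have -> : b = sup S by lra.
have [|e /= e0 Qe] := Qright (sup S) _ Qc; first by rewrite ac.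
pose u := sup S + Num.min (e / 2) (b - sup S).
have cu : sup S < u by rewrite ltrDl lt_min divr_gt0//= subr_gt0.
have ub : u <= b by rewrite -lerBrDl ge_min lexx orbT.
have ue : u <= sup S + e / 2 by rewrite lerD2l ge_min lexx.
suff /(sup_ubound supS.2) : S u by lra.
split=> [|t /andP[at_ tu]]; first by lra.
have [tc|] := ltP t (sup S); first by apply: Qlt; rewrite at_.
rewrite le_eqVlt => /predU1P[<-//|ct].
by apply: Qe => //=; rewrite /ball/= ltr_norml; lra.
Qed.

Lemma nbhs_right_itvco {R : realType} (A : set R) (y : R) : nbhs y A ->
  \forall z \near y^'+, `[y, z[ `<=` A.
Proof.
move=> /nbhs_ballP[e /= e0 eA]; near=> z => t/=.
rewrite in_itv/= => /andP[yt tz]; apply: eA.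
have ze : z < y + e by near: z; apply: nbhs_right_lt; rewrite ltrDl.
by rewrite /ball/= ltr_norml; lra.
Unshelve. all: by end_near. Qed.

Definition right_le {R : realType} (mu nu : set R -> \bar R) (y : R) : Prop :=
  \forall z \near y^'+, (mu `[y, z[%classic <= nu `[y, z[%classic)%E.

Lemma right_le_trans {R : realType} (nu mu la : set R -> \bar R) (y : R) :
  right_le mu nu y -> right_le nu la y -> right_le mu la y.
Proof. by apply: filterS2 => z; exact: le_trans. Qed.

Lemma right_leZ {R : realType} (mu : {measure set R -> \bar R}) (a b y : R) :
  a <= b -> right_le (fun A => a%:E * mu A)%E (fun A => b%:E * mu A)%E y.
Proof. by move=> ab; apply: nearW => z; rewrite lee_wpmul2r. Qed.

Section right_interval_comparison.
Context {R : realType}.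

Lemma measure_itvcoD (mu : {measure set R -> \bar R}) (a c b : R) :
  a <= c <= b ->
  mu `[a, b[%classic = (mu `[a, c[%classic + mu `[c, b[%classic)%E.
Proof.
move=> /andP[ac cb].
have -> : `[a, b[%classic = `[a, c[ `|` `[c, b[ :> set R.
  by rewrite (@itv_bndbnd_setU _ _ _ (BLeft c)).
rewrite measureU// -subset0 => z [/=]; rewrite !in_itv/= => /andP[_ zc].
by rewrite leNgt zc.
Qed.

Lemma cvg_measure_itvco (mu : {measure set R -> \bar R}) (a c : R) :
  mu `[a, c - n.+1%:R^-1]%classic @[n --> \oo] --> mu `[a, c[%classic.
Proof.
rewrite itv_bnd_open_bigcup.
apply: nondecreasing_cvg_mu => [n||m n mn]; first exact: measurable_itv.
  by apply: bigcupT_measurable => n; exact: measurable_itv.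
apply/subsetPset; apply: subset_itvl.
by rewrite bnd_simp lerB// lef_pV2 ?posrE// ler_nat.
Qed.

Variables mu nu : {measure set R -> \bar R}.

Lemma le_measure_itvco (a b : R) : (forall y, right_le mu nu y) -> a <= b ->
  (mu `[a, b[%classic <= nu `[a, b[%classic)%E.
Proof.
move=> mu_nu ab.
apply: (@real_induction _
  (fun c => mu `[a, c[%classic <= nu `[a, c[%classic)%E a b ab).
- move=> c _ lt_c; have mu_cvg := @cvg_measure_itvco mu a c.
  apply: (cvge_to_le mu_cvg); apply: nearW => n.
  pose t := c - n.+2%:R^-1.
  have nt : c - n.+1%:R^-1 < t by rewrite ltrD2l ltrN2 ltf_pV2 ?posrE// ltr_nat.
  have tc : t < c by rewrite gtrBl invr_gt0.
  have [at_|ta] := leP a t; last first.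
    by rewrite set_itv_ge ?measure0// bnd_simp -ltNge (lt_trans nt).
  apply: (@le_trans _ _ (mu `[a, t[%classic)).
    by apply: le_measure; rewrite ?inE//; apply: subset_itvl; rewrite bnd_simp.
  apply: (le_trans (lt_c t _)); first by rewrite at_.
  apply: le_measure; rewrite ?inE//; apply: subset_itvl.
  by rewrite bnd_simp ltW.
- move=> c /andP[ac _] le_c; near=> t.
  have ct : c <= t by near: t; exact: nbhs_right_ge.
  rewrite !(@measure_itvcoD _ a c t) ?ac//.
  by apply: leeD le_c _; near: t; exact: mu_nu.
Unshelve. all: by end_near. Qed.

Lemma le_measureT : (forall y, right_le mu nu y) -> (mu setT <= nu setT)%E.
Proof.
move=> mu_nu.
have mu_cvg : mu `[- n%:R, n%:R[%classic @[n --> \oo] --> mu setT.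
  rewrite -(bigcup_itvT true true).
  apply: nondecreasing_cvg_mu => [n||m n mn]; first exact: measurable_itv.
    by apply: bigcupT_measurable => n; exact: measurable_itv.
  by apply/subsetPset; apply: subset_itv; rewrite bnd_simp ?lerN2 ler_nat.
apply: (cvge_to_le mu_cvg); apply: nearW => n.
apply: (le_trans (le_measure_itvco mu_nu _)).
  by apply: (@le_trans _ _ 0); rewrite ?oppr_le0.
by apply: le_measure; rewrite ?inE.
Qed.

End right_interval_comparison.

Lemma le_measure_closed_open {R : realType} (mu nu : {measure set R -> \bar R})
    (K U : set R) : closed K -> open U -> K `<=` U ->
  (forall y, K y -> right_le mu nu y) ->
  (mu K <= nu U)%E.
Proof.
move=> cK oU KU mu_nu.
have mK := closed_measurable cK; have mU := open_measurable oU.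
rewrite -(setTI K) -(setTI U).
apply: (@le_measureT _ (mrestr mu mK) (mrestr nu mU)) => y.
rewrite /right_le/= /mrestr; have [Ky|nKy] := pselect (K y); near=> z.
- have yzU : `[y, z[ `<=` U.
    by near: z; apply/nbhs_right_itvco/open_nbhs_nbhs; split => //; exact: KU.
  rewrite (setIidl yzU); apply: (@le_trans _ _ (mu `[y, z[%classic)).
    by apply: measureIl => //; exact: measurable_itv.
  by near: z; exact: mu_nu.
- have /subsets_disjoint : `[y, z[ `<=` ~` K.
    near: z; apply/nbhs_right_itvco/open_nbhs_nbhs.
    by split => //; rewrite openC.
  by rewrite setCK => ->; rewrite measure0.
Unshelve. all: by end_near. Qed.

Lemma le_measure_right {R : realType} (mu nu : {finite_measure set R -> \bar R})
    (A : set R) : measurable A ->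
  (forall y, A y -> right_le mu nu y) -> (mu A <= nu A)%E.
Proof.
move=> mA mu_nu; apply/lee_addgt0Pr => e e0.
have e20 : 0 < e / 2 by rewrite divr_gt0.
have [K [cK KA muAK]] := closed_inner_approx mu mA e20.
have [U [oU AU nuUA]] := open_outer_approx nu mA e20.
have -> : (nu A + e%:E = nu A + (e / 2)%:E + (e / 2)%:E)%E.
  by rewrite -addeA -EFinD -splitr.
apply: (le_trans muAK); rewrite leeD2r//; apply: le_trans nuUA.
apply: le_measure_closed_open => //; first exact: subset_trans AU.
by move=> y /KA; exact: mu_nu.
Qed.

Section level_sets.
Context d {T : measurableType d} {R : realType}.
Variables (B : set T) (b : T -> R) (delta : R).
Hypotheses (mB : measurable B) (mb : measurable_fun B b).
Hypotheses (b0 : forall y, B y -> 0 <= b y) (delta0 : 0 < delta).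

Definition level_set (n : nat) : set T :=
  B `&` b @^-1` `[n%:R * delta, n.+1%:R * delta[.

Lemma measurable_level_set n : measurable (level_set n).
Proof. by apply: mb => //; exact: measurable_itv. Qed.

Lemma bigcup_level_set : \bigcup_n level_set n = B.
Proof.
apply/seteqP; split=> [y [n _ []]//|y By].
have : 0 <= b y / delta by rewrite divr_ge0 ?b0// ltW.
move=> /truncn_itv/andP[le_by by_lt].
exists (Num.truncn (b y / delta)) => //; split => //=.
by rewrite in_itv/= -ler_pdivlMr// le_by -ltr_pdivrMr.
Qed.

Lemma trivIset_level_set : trivIset setT level_set.
Proof.
apply/trivIsetP => i j _ _; apply: contraNeq => /eqP/eqP/set0P[y [[_]]]/=.
rewrite in_itv/= => /andP[i1 i2] [_]/=; rewrite in_itv/= => /andP[j1 j2].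
have := le_lt_trans i1 j2; rewrite ltr_pM2r// ltr_nat ltnS => ij.
have := le_lt_trans j1 i2; rewrite ltr_pM2r// ltr_nat ltnS => ji.
by rewrite eqn_leq ij ji.
Qed.

Variable nu : {measure set T -> \bar R}.

Lemma measure_level_setE : nu B = (\sum_(n <oo) nu (level_set n))%E.
Proof.
rewrite -{1}bigcup_level_set measure_semi_bigcup ?bigcup_level_set//.
- exact: measurable_level_set.
- exact: trivIset_level_set.
Qed.

Lemma integral_level_setE :
  (\int[nu]_(y in B) (b y)%:E =
   \sum_(n <oo) \int[nu]_(y in level_set n) (b y)%:E)%E.
Proof.
rewrite -{1}bigcup_level_set ge0_integral_bigcup ?bigcup_level_set//.
- exact: measurable_level_set.
- exact/measurable_EFinP.
- exact: trivIset_level_set.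
Qed.

Lemma level_set_le_integral n :
  ((n%:R * delta)%:E * nu (level_set n) <=
   \int[nu]_(y in level_set n) (b y)%:E)%E.
Proof.
have mE := measurable_level_set n.
rewrite -integral_cst//; apply: ge0_le_integral => //.
- by move=> y _; rewrite lee_fin mulr_ge0// ltW.
- by apply/measurable_EFinP; apply: measurable_funS mb => // y [].
- by move=> y [_]/=; rewrite in_itv/= lee_fin => /andP[].
Qed.

Lemma integral_level_set_le n :
  (\int[nu]_(y in level_set n) (b y)%:E <=
   (n.+1%:R * delta)%:E * nu (level_set n))%E.
Proof.
have mE := measurable_level_set n.
rewrite -integral_cst//; apply: ge0_le_integral => //.
- by move=> y [/b0]; rewrite lee_fin.
- by apply/measurable_EFinP; apply: measurable_funS mb => // y [].
- by move=> y [_]/=; rewrite in_itv/= lee_fin => /andP[_ /ltW].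
Qed.

End level_sets.

Lemma lee_addgt0_mul {R : realType} (x y z : \bar R) :
  (0 <= z)%E -> z \is a fin_num ->
  (forall delta : R, 0 < delta -> (x <= y + delta%:E * z)%E) -> (x <= y)%E.
Proof.
move=> z0 zfin xyz; apply/lee_addgt0Pr => e e0.
have z10 : 0 < fine z + 1 by rewrite ltr_wpDl// fine_ge0.
apply: (le_trans (xyz (e / (fine z + 1)) _)); first by rewrite divr_gt0.
rewrite leeD2l// -[in leLHS](fineK zfin) -EFinM lee_fin mulrAC ler_pdivrMr//.
by rewrite ler_pM2l// lerDl.
Qed.

Section finite_mscale.
Context d {T : measurableType d} {R : realType}.
Variables (r : {nonneg R}) (mu : {finite_measure set T -> \bar R}).

Let mscale_fin_num : fin_num_fun (mscale r mu).
Proof. by move=> A mA; rewrite /mscale fin_numM// fin_num_measure. Qed.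

HB.instance Definition _ := Measure_isFinite.Build _ _ _ (mscale r mu)
  mscale_fin_num.

End finite_mscale.

Section density_comparison.
Context {R : realType} (mu nu : {finite_measure set R -> \bar R}).
Variables (B : set R) (b : R -> R).
Hypotheses (mB : measurable B) (mb : measurable_fun B b).
Hypothesis b0 : forall y, B y -> 0 <= b y.

Lemma le_measure_integral :
  (forall y, B y -> right_le mu (fun A => (b y)%:E * nu A)%E y) ->
  (mu B <= \int[nu]_(y in B) (b y)%:E)%E.
Proof.
move=> mu_nu; apply: (@lee_addgt0_mul _ _ _ (nu B)) => [||delta delta0] //.
  exact: fin_num_measure.
have mE := measurable_level_set delta mB mb.
rewrite (integral_level_setE mB mb b0 delta0).
rewrite !(measure_level_setE mB mb b0 delta0).
rewrite -nneseriesZl// -nneseriesD//=; last 2 first.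
- by move=> n _ _; apply: integral_ge0 => y [/b0]; rewrite lee_fin.
- by move=> n _ _; rewrite mule_ge0// lee_fin ltW.
apply: lee_nneseries => // n _.
have r0 : 0 <= n.+1%:R * delta by rewrite mulr_ge0// ltW.
have : (mu (level_set B b delta n) <=
    mscale (NngNum r0) nu (level_set B b delta n))%E.
  apply: le_measure_right => // y [By]/=; rewrite in_itv/= => /andP[_ /ltW byn].
  exact/(right_le_trans (mu_nu y By))/right_leZ.
move=> /le_trans; apply; rewrite /mscale/= -natr1 mulrDl mul1r EFinD.
rewrite ge0_muleDl ?lee_fin ?mulr_ge0 ?(ltW delta0)// leeD2r//.
exact: level_set_le_integral.
Qed.

Lemma le_integral_measure :
  (forall y, B y -> right_le (fun A => (b y)%:E * nu A)%E mu y) ->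
  (\int[nu]_(y in B) (b y)%:E <= mu B)%E.
Proof.
move=> nu_mu; apply: (@lee_addgt0_mul _ _ _ (nu B)) => [||delta delta0] //.
  exact: fin_num_measure.
have mE := measurable_level_set delta mB mb.
rewrite (integral_level_setE mB mb b0 delta0).
rewrite !(measure_level_setE mB mb b0 delta0).
rewrite -nneseriesZl// -nneseriesD//=; last first.
  by move=> n _ _; rewrite mule_ge0// lee_fin ltW.
apply: lee_nneseries => [n _ _|n _].
  by apply: integral_ge0 => y [/b0]; rewrite lee_fin.
have r0 : 0 <= n%:R * delta by rewrite mulr_ge0// ltW.
have : (mscale (NngNum r0) nu (level_set B b delta n) <=
    mu (level_set B b delta n))%E.
  apply: le_measure_right => // y [By]/=; rewrite in_itv/= => /andP[nby _].
  by apply: right_le_trans (nu_mu y By); exact: right_leZ.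
move=> nmu.
apply: (@le_trans _ _ ((n.+1%:R * delta)%:E * nu (level_set B b delta n))%E).
  exact: integral_level_set_le.
rewrite -natr1 mulrDl mul1r EFinD ge0_muleDl ?lee_fin ?mulr_ge0 ?(ltW delta0)//.
by rewrite leeD2r.
Qed.

End density_comparison.

(** * Conditional dependence *)

Section event_law.
Context d {T : measurableType d} {R : realType} (P : probability T R).
Variables (A : set T) (mA : measurable A) (Y : {RV P >-> R}).

Definition event_law : set R -> \bar R := pushforward (mrestr P mA) Y.

Let event_law0 : event_law set0 = 0%E.
Proof. exact: measure0. Qed.

Let event_law_ge0 B : (0 <= event_law B)%E.
Proof. exact: measure_ge0. Qed.

Let event_law_sigma_additive : semi_sigma_additive event_law.
Proof. exact: measure_semi_sigma_additive. Qed.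

HB.instance Definition _ := isMeasure.Build _ _ _ event_law
  event_law0 event_law_ge0 event_law_sigma_additive.

Let event_law_fin_num : fin_num_fun event_law.
Proof.
move=> B mB; apply: (fin_num_measure (mrestr P mA)).
exact: measurable_funPTI.
Qed.

HB.instance Definition _ := Measure_isFinite.Build _ _ _ event_law
  event_law_fin_num.

End event_law.
Arguments event_law {d T R} P {A} mA Y.

Section le_event_law.
Context d {T : measurableType d} {R : realType} (P : probability T R).
Variables (A A' : set T) (mA : measurable A) (mA' : measurable A').
Variables (Y : {RV P >-> R}) (B : set R).
Hypothesis mB : measurable B.

Lemma le_event_law : (forall w, B (Y w) -> A w -> A' w) ->
  (event_law P mA Y B <= event_law P mA' Y B)%E.
Proof.
move=> AA'; have mYB : measurable (Y @^-1` B) by exact: measurable_funPTI.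
apply: le_measure; rewrite ?inE; [exact: measurableI|exact: measurableI|].
by move=> w [YBw Aw]; split=> //; exact: AA'.
Qed.

Lemma event_law_le_distribution : (event_law P mA Y B <= distribution P Y B)%E.
Proof. by apply: measureIl => //; exact: measurable_funPTI. Qed.

End le_event_law.

Lemma measurable_gt d {T : measurableType d} {R : realType}
    (Z : {mfun T >-> R}) (x : R) : measurable [set w | x < Z w].
Proof. by rewrite -preimage_itvoy; exact: measurable_funPTI. Qed.

Local Notation tail_law P Z Y u := (event_law P (measurable_gt Z%R u) Y).

Section tail.
Context d {T : measurableType d} {R : realType} {P : probability T R}.
Implicit Types X Y Z : {RV P >-> R}.

Lemma tailPE Z x : P [set w | x < Z w] = (tailP P Z x)%:E.
Proof. by rewrite /tailP fineK// fin_num_measure//; exact: measurable_gt. Qed.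

Lemma tailP_nonincreasing Z : nonincreasing_fun (tailP P Z).
Proof.
move=> x y xy; rewrite -lee_fin -!tailPE; apply: le_measure; rewrite ?inE.
- exact: measurable_gt.
- exact: measurable_gt.
- by move=> w /=; exact: le_lt_trans.
Qed.

Lemma distribution_null_notin_DY Y y : 0 < y -> ~ DY P Y y ->
  \forall z \near y^'+, distribution P Y `[y, z[%classic = 0%E.
Proof.
move=> y0 /not_andP[//|/existsNP[r /not_implyP[r0 /negP]]].
rewrite -leNgt measure_le0 => /eqP null; near=> z.
have zr : z < y + r by near: z; apply: nbhs_right_lt; rewrite ltrDl.
apply: subset_measure0 (null) => [||w].
- exact: measurable_funPTI.
- rewrite (_ : mkset _ = Y @^-1` `]y - r, y + r[)//.
  exact: measurable_funPTI.
- by rewrite /preimage/= in_itv/=; lra.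
Unshelve. all: by end_near. Qed.

Lemma cond_ratioE X Y u y t : cond_ratio P X Y u y t =
  fine (tail_law P X Y u `[y, y + t[%classic) /
  fine (distribution P Y `[y, y + t[%classic).
Proof.
congr (fine (P _) / fine (P _)); apply/seteqP.
by split=> w; rewrite /preimage/= in_itv/= => -[].
Qed.

End tail.

Section fine_ratio.
Context {R : realType} (i j : \bar R) (a : R).
Hypotheses (ifin : i \is a fin_num) (j0 : (0 <= j)%E) (ji : (j <= i)%E).

Let jfin : j \is a fin_num.
Proof. by rewrite ge0_fin_numE// (le_lt_trans ji)// ltey_eq ifin. Qed.

Let j_eq0 : fine i = 0 -> j = 0%E.
Proof.
move=> i0; apply/eqP; rewrite eq_le j0 andbT.
by rewrite (le_trans ji)// -(fineK ifin) i0.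
Qed.

Let i_gt0 : fine i != 0 -> 0 < fine i.
Proof. by move=> i0; rewrite lt_neqAle eq_sym i0 fine_ge0// (le_trans j0). Qed.

Lemma lt_fine_ratio : a < fine j / fine i -> (a%:E * i <= j)%E.
Proof.
have [/[dup] i0 /j_eq0 ->|/i_gt0 i0] := eqVneq (fine i) 0.
  by rewrite -(fineK ifin) i0 mule0.
by rewrite ltr_pdivlMr// -(fineK ifin) -(fineK jfin) -EFinM lee_fin => /ltW.
Qed.

Lemma fine_ratio_lt : fine j / fine i < a -> (j <= a%:E * i)%E.
Proof.
have [/[dup] i0 /j_eq0 ->|/i_gt0 i0] := eqVneq (fine i) 0.
  by rewrite -(fineK ifin) i0 mule0.
by rewrite ltr_pdivrMr// -(fineK ifin) -(fineK jfin) -EFinM lee_fin => /ltW.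
Qed.

End fine_ratio.

Section conditional_dependence.
Context d {T : measurableType d} {R : realType} {P : probability T R}.
Variables (X Y : {RV P >-> R}) (s : R -> R).
Hypothesis tail_gt0 : forall x, 0 < tailP P X x.
Hypothesis CDXY : CD P X Y s.

Lemma CD_weight_gt0 y : 0 < y -> 0 < s y.
Proof. by move=> /ltW; case: CDXY => + _; apply. Qed.

Lemma CD_measurable_weight : measurable_fun (`]0, +oo[%classic : set R) s.
Proof.
case: CDXY => _ [ms _]; apply: measurable_funS ms; first exact: measurable_itv.
by apply: subset_itvr; rewrite bnd_simp.
Qed.

Lemma CD_cond_tail_bounds (e : R) : 0 < e -> \forall u \near +oo,
  forall y, DY P Y y -> (1 - e) * (tailP P X u * s y) < cond_tail P X Y u y <
    (1 + e) * (tailP P X u * s y).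
Proof.
move=> e0; case: CDXY => _ [_ [_ unif]].
have e20 : 0 < e / 2 by rewrite divr_gt0.
have [x0 tail_le] := unif _ e20; exists x0; split; first exact: num_real.
move=> u x0u y yD; have [y0 _] := yD.
have Fs0 : 0 < tailP P X u * s y by rewrite mulr_gt0// CD_weight_gt0.
have := tail_le u x0u y yD; rewrite ler_norml => /andP[].
rewrite lerBrDr ler_pdivlMr// lerBlDr ler_pdivrMr// => lo hi.
by apply/andP; split; [apply: lt_le_trans lo|apply: (le_lt_trans hi)];
  rewrite ltr_pM2r//; lra.
Qed.

Lemma CD_right_le (e : R) : 0 < e -> \forall u \near +oo, forall y, 0 < y ->
  right_le (fun B => ((1 - e) * (tailP P X u * s y))%:E * distribution P Y B)%E
    (tail_law P X Y u) y /\
  right_le (tail_law P X Y u)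
    (fun B => ((1 + e) * (tailP P X u * s y))%:E * distribution P Y B)%E y.
Proof.
move=> e0; apply: filterS (CD_cond_tail_bounds e0) => u cond_tail_bounds y y0.
have law_le z := event_law_le_distribution (P := P) (measurable_gt X u) Y
  (measurable_itv `[y, z[).
have fin_dist z :=
  fin_num_measure (distribution P Y) _ (measurable_itv `[y, z[).
have [yD|/(distribution_null_notin_DY y0) null] := pselect (DY P Y y);
  last first.
  by split; apply: filterS null => z null; have := law_le z;
    rewrite null mule0.
have /andP[lo hi] := cond_tail_bounds y yD.
have cvg_ratio : cond_tail_exists P X Y u y by case: CDXY => _ [_ [+ _]]; apply.
split; apply/nbhs_right0P.
- apply: filterS (cvgr_gt _ cvg_ratio _ lo) => t; rewrite cond_ratioE.
  exact: (lt_fine_ratio (fin_dist _) (measure_ge0 _ _) (law_le _)).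
- apply: filterS (cvgr_lt _ cvg_ratio _ hi) => t; rewrite cond_ratioE.
  exact: (fine_ratio_lt (fin_dist _) (measure_ge0 _ _) (law_le _)).
Qed.

End conditional_dependence.

(** * Regular variation *)

Lemma near_pinfty_upward {R : realType} (Q : R -> Prop) :
  (\forall x \near +oo, Q x) ->
  \forall z \near +oo, forall x, z <= x -> Q x.
Proof.
move=> [M [Mreal MQ]]; exists M; split=> // z Mz x zx.
by apply: MQ; exact: lt_le_trans zx.
Qed.

Lemma powR_invN {R : realType} (c a : R) : 0 <= c -> c^-1 `^ (- a) = c `^ a.
Proof. by move=> c0; rewrite -powR_inv1// -powRrM mulN1r opprK. Qed.

Section regular_variation.
Context {R : realType}.
Variables (F : R -> R) (alpha : R).
Hypotheses (F_gt0 : forall x, 0 < F x) (rvF : regvar_tail F alpha).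

Lemma regvar_tail_div_cvg (c : R) : 0 < c ->
  F (x / c) / F x @[x --> +oo] --> c `^ alpha.
Proof.
by move=> c0; rewrite -powR_invN ?(ltW c0)//; apply: rvF; rewrite invr_gt0.
Qed.

Lemma regvar_tail_div_le (c K : R) : 0 < c -> c `^ alpha < K ->
  \forall x \near +oo, F (x / c) <= K * F x.
Proof.
move=> c0 cK; apply: filterS (cvgr_lt _ (regvar_tail_div_cvg c0) _ cK) => x.
by rewrite ltr_pdivrMr// => /ltW.
Qed.

Lemma regvar_tail_dilation (e : R) : 0 <= alpha -> 0 < e ->
  exists2 rho : R, 1 < rho & \forall x \near +oo, F (x / rho) <= (1 + e) * F x.
Proof.
move=> alpha0 e0.
have [rho rho1 rhoe] : exists2 rho : R, 1 < rho & rho `^ alpha < 1 + e.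
  have p0 : 0 < (alpha + 1)^-1 by rewrite invr_gt0 ltr_wpDl.
  exists ((1 + e / 2) `^ (alpha + 1)^-1).
    have := @gt0_ltr_powR R _ p0 1 (1 + e / 2).
    by rewrite powR1 !nnegrE; apply; lra.
  rewrite -powRrM; apply: (@le_lt_trans _ _ (1 + e / 2)); last by lra.
  rewrite -[leRHS]powRr1; last by lra.
  rewrite ler_powR//; first by lra.
  by rewrite mulrC ler_pdivrMr; lra.
by exists rho => //; apply: regvar_tail_div_le => //; exact: lt_trans rho1.
Qed.

End regular_variation.

Section doubling.
Context {R : realType}.
Variables (F : R -> R) (p z : R).
Hypotheses (p0 : 0 <= p) (z0 : 0 <= z).
Hypothesis doubling : forall u, z <= u -> F (u / 2) <= 2 `^ p * F u.

Lemma doubling_iter n (x : R) : z * 2 ^+ n <= x ->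
  F (x / 2 ^+ n.+1) <= (2 ^+ n.+1) `^ p * F x.
Proof.
elim: n => [|n IH] zx; first by apply: doubling; rewrite mulr1 in zx.
rewrite [in leLHS]exprSr invfM mulrA.
have zxn : z <= x / 2 ^+ n.+1 by rewrite ler_pdivlMr ?exprn_gt0.
apply: (le_trans (doubling zxn)).
rewrite [2 ^+ n.+2]exprS powRM ?exprn_ge0// -mulrA ler_wpM2l ?powR_ge0// IH//.
by apply: le_trans zx; rewrite ler_wpM2l// exprS ler_peMl ?exprn_ge0// ler1n.
Qed.

Lemma doubling_power_le (x y : R) :
  (forall u, 0 < F u) -> nonincreasing_fun F -> 1 <= y -> z * y <= x ->
  F (x / y) <= 2 `^ p * y `^ p * F x.
Proof.
move=> F_gt0 nF y1 zyx.
have y0 : 0 < y by apply: lt_le_trans y1.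
have [n /andP[ny yn]] : exists n, 2 ^+ n <= y < 2 ^+ n.+1.
  have := truncn_itv (ltW y0); set m := Num.truncn y => /andP[my ym].
  have m0 : (0 < m)%N by rewrite truncn_gt0.
  exists (trunc_log 2 m); rewrite -!natrX.
  rewrite (le_trans _ my) ?ler_nat ?trunc_logP//.
  by rewrite (lt_le_trans ym)// ler_nat trunc_log_ltn.
have zx : z * 2 ^+ n <= x by apply: le_trans zyx; rewrite ler_wpM2l.
have x0 : 0 <= x by apply: le_trans zx; rewrite mulr_ge0.
apply: (@le_trans _ _ (F (x / 2 ^+ n.+1))).
  by apply: nF; rewrite ler_wpM2l// lef_pV2 ?posrE ?exprn_gt0// ltW.
apply: (le_trans (doubling_iter zx)); have y_ge0 := ltW y0.
rewrite ler_wpM2r ?(ltW (F_gt0 x))// -powRM// ge0_ler_powR ?nnegrE ?mulr_ge0//.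
by rewrite exprS ler_wpM2l.
Qed.

End doubling.

Lemma potter_bound {R : realType} (F : R -> R) (alpha p : R) :
  (forall x, 0 < F x) -> nonincreasing_fun F -> regvar_tail F alpha ->
  0 <= p -> alpha < p ->
  \forall z \near +oo, forall x y, 1 <= y -> z * y <= x ->
    F (x / y) <= 2 `^ p * y `^ p * F x.
Proof.
move=> F_gt0 nF rvF p0 alphap.
have alphap2 : 2 `^ alpha < 2 `^ p.
  by rewrite /powR gt_eqF// ltr_expR ltr_pM2r// ln_gt0// ltr1n.
have doubling := near_pinfty_upward
  (regvar_tail_div_le F_gt0 rvF (ltr0Sn R 1) alphap2).
apply: filterS2 doubling (nbhs_pinfty_ge (num_real 0)).
by move=> z doubling z0 x y; exact: doubling_power_le.
Qed.

(** * Truncated means *)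

Lemma dominated_cvg_pinfty d (T : measurableType d) (R : realType)
    (mu : {measure set T -> \bar R}) (D : set T)
    (f : R -> T -> \bar R) (l g : T -> \bar R) :
  measurable D -> (forall x, measurable_fun D (f x)) -> measurable_fun D l ->
  (forall w, D w -> f x w @[x --> +oo] --> l w) -> mu.-integrable D g ->
  (\forall x \near +oo, forall w, D w -> (`|f x w| <= g w)%E) ->
  (\int[mu]_(w in D) f x w)%E @[x --> +oo] --> (\int[mu]_(w in D) l w)%E.
Proof.
move=> mD mf ml fl ig [M [_ fg]]; apply/cvge_pinftyP => u uy.
have [N _ uM] := (cvgryPgt u).1 uy M.
rewrite -(cvg_shiftn N).
have [] := @dominated_convergence _ _ _ mu D mD (fun n => f (u (n + N)%N)) l g.
- by move=> n; exact: mf.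
- exact: ml.
- apply: aeW => w Dw.
  apply: (cvg_comp (fun n => u (n + N)%N) (f ^~ w) _ (fl w Dw)).
  by rewrite cvg_shiftn.
- exact: ig.
- by apply: aeW => w n Dw; apply: fg => //; apply: uM; rewrite /= leq_addl.
by [].
Qed.

Section weighted_moment.
Context {R : realType}.
Variables (G : {measure set R -> \bar R}) (s : R -> R).

Definition weighted_moment (p : R) : \bar R :=
  (\int[G]_(y in `]0%R, +oo[) (y `^ p * s y)%:E)%E.

Hypothesis ms : measurable_fun (`]0, +oo[%classic : set R) s.
Hypothesis s_gt0 : forall y, 0 < y -> 0 < s y.

Let weighted_power_gt0 p y :
  (`]0, +oo[%classic : set R) y -> 0 < y `^ p * s y.
Proof.
by rewrite /= in_itv/= andbT => y0; rewrite mulr_gt0 ?powR_gt0 ?s_gt0.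
Qed.

Let weighted_power_ge0 p y :
  (`]0, +oo[%classic : set R) y -> (0 <= (y `^ p * s y)%:E)%E.
Proof. by move=> /weighted_power_gt0/ltW; rewrite lee_fin. Qed.

Lemma measurable_weighted_power p :
  measurable_fun (`]0, +oo[%classic : set R) (fun y => y `^ p * s y).
Proof.
apply: measurable_funM => //; apply: measurable_funTS.
exact: measurable_powR.
Qed.

Lemma integrable_weighted_power p : (weighted_moment p < +oo)%E ->
  G.-integrable `]0, +oo[%classic (fun y => (y `^ p * s y)%:E).
Proof.
move=> Mp; apply/integrableP; split.
  by apply/measurable_EFinP; exact: measurable_weighted_power.
rewrite (eq_integral (fun y => (y `^ p * s y)%:E))// => y /set_mem y0.
by rewrite gee0_abs// weighted_power_ge0.
Qed.

Lemma integrable_weighted_power_add1 (C p : R) :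
  (weighted_moment 0 < +oo)%E -> (weighted_moment p < +oo)%E ->
  G.-integrable `]0, +oo[%classic (fun y => (C * (1 + y `^ p) * s y)%:E).
Proof.
move=> /integrable_weighted_power i0 /integrable_weighted_power ip.
have i0p := integrableD (measurable_itv _) i0 ip.
have := integrableZl (measurable_itv _) C i0p.
apply: eq_integrable => // y _.
by rewrite powRr0 -EFinD -EFinM; congr EFin; ring.
Qed.

Lemma weighted_moment_gt0 p : (0 < G `]0%R, +oo[%classic)%E ->
  (0 < weighted_moment p)%E.
Proof.
move=> GD; rewrite lt_neqAle integral_ge0 ?andbT; last first.
  by move=> y; exact: weighted_power_ge0.
apply/eqP => M0.
have [] := (ae_eq_integral_abs G (measurable_itv `]0, +oo[)
  ((measurable_EFinP _ _).2 (measurable_weighted_power p))).1.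
  rewrite [RHS]M0; apply: eq_integral => y /set_mem y0.
  by rewrite gee0_abs// weighted_power_ge0.
move=> N [mN GN notN].
suff GD0 : G `]0, +oo[%classic = 0%E by rewrite GD0 ltxx in GD.
apply: subset_measure0 GN => // y y0; apply: notN => /= /(_ y0)[].
by apply/eqP; rewrite gt_eqF// weighted_power_gt0.
Qed.

Lemma weighted_moment_lty p q : 0 <= p -> p <= q ->
  (weighted_moment 0 < +oo)%E -> (weighted_moment q < +oo)%E ->
  (weighted_moment p < +oo)%E.
Proof.
move=> p0 pq /integrable_weighted_power i0 /integrable_weighted_power iq.
have /integrableP[mD] := integrableD (measurable_itv _) i0 iq.
apply: le_lt_trans; apply: ge0_le_integral => //.
- by move=> y; exact: weighted_power_ge0.
- by apply/measurable_EFinP; exact: measurable_weighted_power.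
- exact: measurableT_comp.
move=> y y0; rewrite gee0_abs ?adde_ge0 ?weighted_power_ge0// lee_fin -mulrDl.
move: y0; rewrite /= in_itv/= andbT => y0.
rewrite ler_wpM2r ?(ltW (s_gt0 y0))//.
have [y1|y1] := leP 1 y.
  by apply: (le_trans (ler_powR y1 pq)); rewrite lerDr powR_ge0.
rewrite -[leLHS]addr0 lerD ?powR_ge0//.
by rewrite ger_powR// y0 ltW.
Qed.

End weighted_moment.

Definition truncated_mean {R : realType} (F s : R -> R)
    (G : set R -> \bar R) (x c : R) : \bar R :=
  (\int[G]_(y in `]0%R, c]) (F (x / y) * s y)%:E)%E.

Definition power_dominated {R : realType} (F : R -> R) (p : R)
    (h : R -> R) : Prop :=
  exists C, \forall x \near +oo, forall y, 1 <= y <= h x ->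
    F (x / y) <= C * y `^ p * F x.

Lemma power_dominated_le {R : realType} (F : R -> R) (p : R) (h : R -> R) :
  (forall x, 0 < F x) -> nonincreasing_fun F -> power_dominated F p h ->
  exists2 C, 0 <= C & \forall x \near +oo, forall y, 0 < y <= h x ->
    F (x / y) / F x <= C * (1 + y `^ p).
Proof.
move=> F_gt0 nF [C FC]; exists (`|C| + 1) => //.
apply: filterS2 FC (nbhs_pinfty_gt (num_real 0)) => x FC x0 y /andP[y0 yh].
have Fx := F_gt0 x; have yp := powR_ge0 y p; rewrite ler_pdivrMr//.
have [y1|y1] := leP 1 y.
  apply: (@le_trans _ _ (C * y `^ p * F x)).
    by apply: FC; rewrite y1.
  rewrite ler_wpM2r ?(ltW Fx)//; apply: (@le_trans _ _ (`|C| * y `^ p)).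
    by rewrite ler_wpM2r// ler_norm.
  by rewrite ler_pM// ?lerDl ?lerDr.
apply: (@le_trans _ _ (F x)).
  by apply: nF; rewrite ler_pdivlMr// ger_pMr// ltW.
rewrite ler_peMl ?(ltW Fx)// -[leLHS]mulr1 ler_pM// ?lerDr//.
by rewrite lerDl.
Qed.

Section truncated_mean_limit.
Context {R : realType}.
Variables (F s : R -> R) (G : {measure set R -> \bar R}).
Hypotheses (F_gt0 : forall x, 0 < F x) (nF : nonincreasing_fun F).
Hypothesis ms : measurable_fun (`]0, +oo[%classic : set R) s.
Hypothesis s_gt0 : forall y, 0 < y -> 0 < s y.

Lemma measurable_truncated_kernel x (A : set R) : A `<=` `]0, +oo[%classic ->
  measurable_fun A (fun y => F (x / y) * s y).
Proof.
move=> A0; apply: (measurable_funS _ A0) => //.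
apply: measurable_funM => //.
apply: (eq_measurable_fun (F \o (fun y => x * y `^ (-1)))).
  by move=> y /set_mem/=; rewrite in_itv/= andbT => /ltW y0; rewrite powR_inv1.
apply: measurableT_comp; first exact: nonincreasing_measurable.
apply: measurable_funM => //; apply: measurable_funTS.
exact: measurable_powR.
Qed.

Definition truncated_ratio (x c : R) : R -> \bar R :=
  (fun y => ((F x)^-1 * (F (x / y) * s y))%:E) \_ `]-oo, c].

Let itv0c_setI c : `]0, c]%classic = `]0, +oo[ `&` `]-oo, c] :> set R.
Proof. by apply/seteqP; split=> y /=; rewrite !in_itv/= andbT => /andP. Qed.

Lemma measurable_truncated_ratio x c :
  measurable_fun (`]0, +oo[%classic : set R) (truncated_ratio x c).
Proof.
apply/measurable_restrict => //; apply/measurable_EFinP.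
apply: measurable_funM => //; apply: measurable_truncated_kernel.
exact: subIsetl.
Qed.

Lemma integral_truncated_ratio x c :
  ((F x)^-1%:E * truncated_mean F s G x c =
   \int[G]_(y in `]0%R, +oo[) truncated_ratio x c y)%E.
Proof.
rewrite -integral_mkcondr -itv0c_setI -ge0_integralZl_EFin//.
- move=> y /=; rewrite in_itv/= => /andP[y0 _].
  by rewrite lee_fin mulr_ge0 ?ltW ?s_gt0.
- apply/measurable_EFinP; apply: measurable_truncated_kernel.
  by rewrite itv0c_setI; exact: subIsetl.
- by rewrite invr_ge0 ltW.
Qed.

Lemma truncated_ratio_le (x c C p : R) : 0 <= C ->
  (forall y, 0 < y <= c -> F (x / y) / F x <= C * (1 + y `^ p)) ->
  forall y, (`]0, +oo[%classic : set R) y ->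
  (`|truncated_ratio x c y| <= (C * (1 + y `^ p) * s y)%:E)%E.
Proof.
move=> C0 FC y /=; rewrite in_itv/= andbT => y0; have sy := ltW (s_gt0 y0).
rewrite /truncated_ratio patchE; case: ifPn => [/set_mem/=|_]; last first.
  by rewrite abse0 lee_fin !mulr_ge0 ?addr_ge0 ?powR_ge0.
rewrite in_itv/= mulrA [_^-1 * _]mulrC => yc; rewrite lee_fin ger0_norm.
  by rewrite ler_wpM2r// FC ?y0.
by rewrite !mulr_ge0 ?invr_ge0// ltW.
Qed.

Lemma truncated_mean_cvg (alpha p : R) (h : R -> R) : regvar_tail F alpha ->
  (weighted_moment G s 0 < +oo)%E -> (weighted_moment G s p < +oo)%E ->
  h x @[x --> +oo] --> +oo -> power_dominated F p h ->
  ((F x)^-1%:E * truncated_mean F s G x (h x))%E @[x --> +oo] -->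
  weighted_moment G s alpha.
Proof.
move=> rvF M0 Mp hy /(power_dominated_le F_gt0 nF)[C C0 FC].
under eq_cvg do rewrite integral_truncated_ratio.
apply: dominated_cvg_pinfty (integrable_weighted_power_add1 ms s_gt0 C M0 Mp) _.
- exact: measurable_itv.
- by move=> x; exact: measurable_truncated_ratio.
- by apply/measurable_EFinP; exact: measurable_weighted_power.
- move=> y /=; rewrite in_itv/= andbT => y0.
  apply: (@cvg_trans _ ((F (x / y) / F x * s y)%:E @[x --> +oo])).
    apply: near_eq_cvg; apply: filterS ((cvgryPge h).1 hy y) => x yh.
    rewrite /truncated_ratio patchE mem_set/= ?in_itv//=.
    by rewrite mulrA [_^-1 * _]mulrC.
  apply: cvg_EFin; first exact: nearW.
  by apply: cvgMr_tmp; exact: regvar_tail_div_cvg.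
- by apply: filterS FC => x; exact: truncated_ratio_le.
Qed.

End truncated_mean_limit.

(** * The tail of the product *)

Section tail_law_mul.
Context d {T : measurableType d} {R : realType} {P : probability T R}.
Variables (X Y : {RV P >-> R}).

Lemma right_le_tail_law_mul x y : 0 <= x -> 0 < y ->
  right_le (tail_law P X Y (x / y)) (tail_law P (X \* Y) Y x) y.
Proof.
move=> x0 y0; apply: nearW => z; apply: le_event_law => // w /=.
rewrite in_itv/= => /andP[yY _] xyX.
have X0 : 0 < X w by apply: le_lt_trans xyX; rewrite divr_ge0// ltW.
by apply: (@lt_le_trans _ _ (X w * y)); rewrite -?ltr_pdivrMr// ler_pM2l.
Qed.

Hypothesis Y_gt0 : forall w, 0 < Y w.

Lemma tail_law_mul_right_le x y rho : 0 <= x -> 0 < y -> 1 < rho ->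
  right_le (tail_law P (X \* Y) Y x) (tail_law P X Y (x / y / rho)) y.
Proof.
move=> x0 y0 rho1; have rho0 : 0 < rho by exact: lt_trans rho1.
near=> z; apply: le_event_law => // w /=.
rewrite in_itv/= => /andP[_ Yz] xXY.
have X0 : 0 < X w by rewrite -(pmulr_lgt0 _ (Y_gt0 w)); exact: le_lt_trans xXY.
have zrho : z <= rho * y by near: z; apply: nbhs_right_le; rewrite ltr_pMl.
rewrite !ltr_pdivrMr// (lt_le_trans xXY)// -mulrA ler_pM2l//.
exact: le_trans (ltW Yz) zrho.
Unshelve. all: by end_near. Qed.

Variables (s : R -> R) (alpha : R).
Hypothesis tailX_gt0 : forall x, 0 < tailP P X x.
Hypothesis CDXY : CD P X Y s.
Hypothesis alpha0 : 0 <= alpha.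
Hypothesis rvX : regvar_tail (tailP P X) alpha.

Local Notation kernel x y := (tailP P X (x / y) * s y).

(* The factor [1 + e / 3] is lost twice: in the conditional dependence and in
   replacing [x / y] by [x / y / rho]. *)
Lemma tail_law_mul_right_bounds (e : R) : 0 < e < 1 -> \forall u \near +oo,
  forall x y, 0 < y -> u * y <= x ->
  right_le (fun B => ((1 - e) * kernel x y)%:E * distribution P Y B)%E
    (tail_law P (X \* Y) Y x) y /\
  right_le (tail_law P (X \* Y) Y x)
    (fun B => ((1 + e) * kernel x y)%:E * distribution P Y B)%E y.
Proof.
move=> /andP[e0 e1]; have e30 : 0 < e / 3 by rewrite divr_gt0.
have [rho rho1 dilation] := regvar_tail_dilation tailX_gt0 rvX alpha0 e30.
have rho0 : 0 < rho by exact: lt_trans rho1.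
have CD_bounds := CD_right_le tailX_gt0 CDXY e30.
have rhoVy : u / rho @[u --> +oo] --> +oo.
  by apply: gt0_cvgMly; rewrite ?invr_gt0//; exact: cvg_id.
apply: filterS3 (near_pinfty_upward (filterI CD_bounds dilation))
  (rhoVy _ (near_pinfty_upward CD_bounds)) (nbhs_pinfty_ge (num_real 0)).
move=> u bounds bounds_rho u0 x y y0 uyx.
have x0 : 0 <= x by apply: le_trans uyx; rewrite mulr_ge0// ltW.
have uxy : u <= x / y by rewrite ler_pdivlMr.
have uxyrho : u / rho <= x / y / rho by rewrite ler_pM2r ?invr_gt0.
have [/(_ y y0)[lo _] dil] := bounds _ uxy.
have [_ hi] := bounds_rho _ uxyrho y y0.
have s0 := CD_weight_gt0 CDXY y0.
have kernel_gt0 : 0 < kernel x y by rewrite mulr_gt0.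
split.
- apply: right_le_trans (right_le_tail_law_mul x0 y0).
  by apply: right_le_trans lo; apply: right_leZ; rewrite ler_pM2r//; lra.
- apply: (right_le_trans (tail_law_mul_right_le x0 y0 rho1)).
  apply: (right_le_trans hi); apply: right_leZ.
  rewrite mulrA [leRHS]mulrA ler_pM2r//.
  apply: (@le_trans _ _ ((1 + e / 3) * ((1 + e / 3) * tailP P X (x / y)))).
    by apply: ler_wpM2l dil; lra.
  by rewrite mulrA ler_pM2r//; nra.
Qed.

Lemma tail_law_mul_bounds (e : R) : 0 < e < 1 -> \forall u \near +oo,
  forall x c, u * c <= x ->
  ((1 - e)%:E * truncated_mean (tailP P X) s (distribution P Y) x c <=
     tail_law P (X \* Y) Y x `]0%R, c]%classic)%E /\
  (tail_law P (X \* Y) Y x `]0%R, c]%classic <=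
     (1 + e)%:E * truncated_mean (tailP P X) s (distribution P Y) x c)%E.
Proof.
move=> e01; have /andP[e0 e1] := e01.
apply: filterS2 (tail_law_mul_right_bounds e01) (nbhs_pinfty_ge (num_real 0)).
move=> u right_bounds u0 x c ucx.
have uyx y : 0 < y <= c -> u * y <= x.
  by move=> /andP[_ yc]; apply: le_trans ucx; rewrite ler_wpM2l.
have mk : measurable_fun (`]0, c]%classic : set R) (fun y => kernel x y).
  apply: measurable_truncated_kernel.
  - exact: tailP_nonincreasing.
  - exact: (CD_measurable_weight CDXY).
  - by apply: subset_itvl; rewrite bnd_simp.
have k0 y : (`]0, c]%classic : set R) y -> 0 <= kernel x y.
  rewrite /= in_itv/= => /andP[y0 _].
  by rewrite mulr_ge0// ltW// (CD_weight_gt0 CDXY).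
have scaleE r : 0 <= r ->
    (r%:E * truncated_mean (tailP P X) s (distribution P Y) x c =
     \int[distribution P Y]_(y in `]0%R, c]) (r * kernel x y)%:E)%E.
  move=> r0; rewrite -ge0_integralZl_EFin//; exact/measurable_EFinP.
rewrite !scaleE ?subr_ge0 ?addr_ge0 ?(ltW e0) ?(ltW e1)//.
split.
- apply: le_integral_measure => //; first exact: measurable_funM.
    by move=> y /k0 ?; rewrite mulr_ge0// subr_ge0 ltW.
  move=> y /=; rewrite in_itv/= => yc; have /andP[y0 _] := yc.
  by have [] := right_bounds x y y0 (uyx y yc).
- apply: le_measure_integral => //; first exact: measurable_funM.
    by move=> y /k0 ?; rewrite mulr_ge0// addr_ge0// ltW.
  move=> y /=; rewrite in_itv/= => yc; have /andP[y0 _] := yc.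
  by have [] := right_bounds x y y0 (uyx y yc).
Qed.

End tail_law_mul.

Section moments_of_conditional_dependence.
Context d {T : measurableType d} {R : realType} {P : probability T R}.
Variables (X Y : {RV P >-> R}) (s : R -> R).
Hypothesis Y_gt0 : forall w, 0 < Y w.
Hypothesis tailX_gt0 : forall x, 0 < tailP P X x.
Hypothesis CDXY : CD P X Y s.

Let preimage_pos : Y @^-1` `]0, +oo[%classic = setT.
Proof. by rewrite preimage_itvoy -subTset => w _; exact: Y_gt0. Qed.

Lemma distribution_itv0y : distribution P Y `]0%R, +oo[%classic = 1%E.
Proof. by rewrite /distribution /pushforward preimage_pos probability_setT. Qed.

Lemma weighted_moment_distributionE p :
  weighted_moment (distribution P Y) s p =
  (\int[P]_w (Y w `^ p * s (Y w))%:E)%E.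
Proof.
rewrite /weighted_moment ge0_integral_pushforward ?preimage_pos//.
  apply/measurable_EFinP.
  exact: (measurable_weighted_power (CD_measurable_weight CDXY)).
move=> y /set_mem/=; rewrite in_itv/= andbT => y0.
by rewrite lee_fin mulr_ge0 ?powR_ge0// ltW// (CD_weight_gt0 CDXY).
Qed.

Lemma CD_weighted_moment0_lty :
  (weighted_moment (distribution P Y) s 0 < +oo)%E.
Proof.
have h0 : 0 < 2^-1 :> R by rewrite invr_gt0.
have [u _ CDu] := pinfty_ex_gt0 (CD_right_le tailX_gt0 CDXY h0).
pose k := (1 - 2^-1) * tailP P X u.
have k0 : 0 < k by rewrite mulr_gt0//; lra.
have mw := measurable_weighted_power (CD_measurable_weight CDXY) 0.
have w_gt0 y : (`]0, +oo[%classic : set R) y -> 0 < y `^ 0 * s y.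
  rewrite /= in_itv/= andbT powRr0 mul1r.
  exact: (CD_weight_gt0 CDXY).
have : (k%:E * weighted_moment (distribution P Y) s 0 <= 1)%E.
  rewrite -ge0_integralZl_EFin//; last 3 first.
  - by move=> y /w_gt0/ltW; rewrite lee_fin.
  - exact/measurable_EFinP.
  - exact: ltW.
  apply: (@le_trans _ _ (tail_law P X Y u `]0%R, +oo[%classic)).
    apply: (@le_integral_measure _ _ _ _ (fun y => k * (y `^ 0 * s y))) => //.
    - exact: measurable_funM.
    - by move=> y /w_gt0/ltW y0; rewrite mulr_ge0// ltW.
    move=> y; rewrite /= in_itv/= andbT => /CDu[+ _].
    by rewrite powRr0 mul1r /k mulrA.
  by rewrite -distribution_itv0y; exact: event_law_le_distribution.
by apply: contraTT; rewrite -leNgt leye_eq => /eqP ->; rewrite gt0_muley.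
Qed.

End moments_of_conditional_dependence.

Lemma tailP_truncation d {T : measurableType d} {R : realType}
    {P : probability T R} (Z Y : {RV P >-> R}) (x c : R) :
  (forall w, 0 < Y w) ->
  let lawZ := tail_law P Z Y x `]0%R, c]%classic in
  (lawZ <= (tailP P Z x)%:E <= lawZ + (tailP P Y c)%:E)%E.
Proof.
move=> Y_gt0 /=.
have mYc : measurable (Y @^-1` `]0, c]) by exact: measurable_funPTI.
have mZ := measurable_gt Z x; have mY := measurable_gt Y c.
rewrite -!tailPE; apply/andP; split; first exact: measureIr.
apply: (@le_trans _ _
  (P ((Y @^-1` `]0, c] `&` [set w | x < Z w]) `|` [set w | c < Y w]))).
  apply: le_measure; rewrite ?inE//.
    by apply: measurableU => //; exact: measurableI.
  move=> w xZ; have [Yc|] := leP (Y w) c; last by right.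
  by left; split=> //=; rewrite in_itv/= Y_gt0.
by apply: measureU2 => //; exact: measurableI.
Qed.

Lemma cvg_scaled_sandwich {T : Type} {F : set_system T} {FF : Filter F}
    {R : realType} (f : T -> R) (m : R) :
  (forall e, 0 < e < 1 -> exists lo hi : T -> R,
    [/\ lo @ F --> (1 - e) * m, hi @ F --> (1 + e) * m &
      \forall x \near F, lo x <= f x <= hi x]) ->
  f @ F --> m.
Proof.
move=> sandwich; apply/cvgrPdist_le => d d0.
have m10 : 0 < `|m| + 1 by rewrite ltr_wpDl.
pose e := Num.min (d / 2 / (`|m| + 1)) 2^-1.
have e0 : 0 < e by rewrite lt_min !divr_gt0/=.
have e1 : e < 1 by rewrite gt_min; apply/orP; right; lra.
have em : e * `|m| <= d / 2.
  apply: (@le_trans _ _ (e * (`|m| + 1))).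
    by rewrite ler_wpM2l ?lerDl// ltW.
  by rewrite -ler_pdivlMr// ge_min lexx.
have [|lo [hi [lo_cvg hi_cvg lofhi]]] := sandwich e; first by rewrite e0.
have d20 : 0 < d / 2 by rewrite divr_gt0.
move/cvgrPdist_le : lo_cvg => /(_ _ d20) lo_near.
move/cvgrPdist_le : hi_cvg => /(_ _ d20) hi_near.
apply: filterS3 lo_near hi_near lofhi => x lox hix /andP[lof fhi].
have : `|e * m| <= d / 2 by rewrite normrM gtr0_norm.
move: lox hix; rewrite !ler_norml => /andP[? ?] /andP[? ?] /andP[? ?].
by apply/andP; split; lra.
Qed.

(* Below [h x] one has [x / Y >= u], so that conditional dependence applies, and
   the kernel is dominated; above [h x], [Y] is negligible. *)
Definition truncation_level {R : realType} (F Gbar : R -> R) (p u : R)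
    (h : R -> R) : Prop :=
  [/\ h x @[x --> +oo] --> +oo, \forall x \near +oo, u * h x <= x,
    Gbar (h x) / F x @[x --> +oo] --> (0 : R) & power_dominated F p h].

Section product_tail.
Context d {T : measurableType d} {R : realType} {P : probability T R}.
Variables (X Y : {RV P >-> R}) (s : R -> R) (alpha : R).
Hypothesis Y_gt0 : forall w, 0 < Y w.
Hypothesis tailX_gt0 : forall x, 0 < tailP P X x.
Hypothesis CDXY : CD P X Y s.
Hypothesis alpha0 : 0 <= alpha.
Hypothesis rvX : regvar_tail (tailP P X) alpha.

Local Notation F := (tailP P X).
Local Notation G := (distribution P Y).

Lemma product_tail_div_bounds (e : R) : 0 < e < 1 -> \forall u \near +oo,
  forall x c, u * c <= x ->
  let mean := ((F x)^-1%:E * truncated_mean F s G x c)%E in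
  mean \is a fin_num ->
  (1 - e) * fine mean <= tailP P (X \* Y) x / F x <=
  (1 + e) * fine mean + tailP P Y c / F x.
Proof.
move=> e01.
apply: filterS (tail_law_mul_bounds Y_gt0 tailX_gt0 CDXY alpha0 rvX e01).
move=> u bounds x c ucx /=; set mean := (_ * _)%E => mean_fin.
have Fx0 := tailX_gt0 x.
have truncE : truncated_mean F s G x c = (F x * fine mean)%:E.
  by rewrite EFinM (fineK mean_fin) muleA -EFinM divff ?mul1e// gt_eqF.
have /= := tailP_truncation (X \* Y) x c Y_gt0.
have := bounds x c ucx; rewrite truncE.
have /fineK <- := fin_num_measure (tail_law P (X \* Y) Y x) _
  (measurable_itv `]0, c]).
rewrite -!EFinM -EFinD !lee_fin.
move=> [lo hi] /andP[qp pq].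
rewrite ler_pdivlMr// ler_pdivrMr// [(_ + _ / _) * _]mulrDl divfK ?gt_eqF//.
by apply/andP; split; lra.
Qed.

Variable p : R.
Hypotheses (alphap : alpha <= p) (Mp : (weighted_moment G s p < +oo)%E).
Hypothesis levels : forall u, exists h, truncation_level F (tailP P Y) p u h.

Let ms := CD_measurable_weight CDXY.
Let s_gt0 := CD_weight_gt0 CDXY.
Let M0 := CD_weighted_moment0_lty Y_gt0 tailX_gt0 CDXY.

Let Malpha_gt0 : (0 < weighted_moment G s alpha)%E.
Proof.
by apply: weighted_moment_gt0 => //; rewrite [ltRHS]distribution_itv0y.
Qed.

Let Malpha_fin : weighted_moment G s alpha \is a fin_num.
Proof.
rewrite ge0_fin_numE ?(ltW Malpha_gt0)//.
exact: weighted_moment_lty alphap M0 Mp.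
Qed.

Lemma product_tail_div_cvg :
  tailP P (X \* Y) x / F x @[x --> +oo] --> fine (weighted_moment G s alpha).
Proof.
apply: cvg_scaled_sandwich => e e01.
have [u _ bounds] := pinfty_ex_gt0 (product_tail_div_bounds e01).
have [h [hy uhx tailYh dom]] := levels u.
pose mean x := ((F x)^-1%:E * truncated_mean F s G x (h x))%E.
have : mean x @[x --> +oo] --> (fine (weighted_moment G s alpha))%:E.
  rewrite fineK//; apply: truncated_mean_cvg dom => //.
  exact: tailP_nonincreasing.
move=> /fine_cvgP[mean_fin mean_cvg].
exists (fun x => (1 - e) * fine (mean x)).
exists (fun x => (1 + e) * fine (mean x) + tailP P Y (h x) / F x); split.
- exact: cvgMl_tmp.
- by rewrite -[X in _ --> X]addr0; apply: cvgD tailYh; exact: cvgMl_tmp.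
- by apply: filterS2 uhx mean_fin => x; exact: bounds.
Qed.

Lemma product_tail_equiv :
  tailP P (X \* Y) x / (fine (weighted_moment G s alpha) * F x) @[x --> +oo]
    --> (1 : R).
Proof.
have m0 : fine (weighted_moment G s alpha) != 0.
  by rewrite gt_eqF// fine_gt0// Malpha_gt0 ltey_eq Malpha_fin.
under eq_cvg do rewrite invfM mulrCA.
by rewrite -(mulVf m0); apply: cvgMl_tmp; exact: product_tail_div_cvg.
Qed.

End product_tail.

Lemma cvg1_ratio_near_le {T : Type} {F : set_system T} {FF : Filter F}
    {R : realType} (f g : T -> R) :
  f x / g x @[x --> F] --> (1 : R) -> (\forall x \near F, 0 < g x) ->
  \forall x \near F, f x <= 2 * g x /\ g x <= 2 * f x.
Proof.
move=> fg1; apply: filterS3 (cvgr_lt _ fg1 2 _) (cvgr_gt _ fg1 2^-1 _); try lra.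
move=> x + + g0; rewrite ltr_pdivrMr// ltr_pdivlMr// => fg gf.
by split; lra.
Qed.

Lemma truncation_level_div {R : realType} (F Gbar : R -> R) (alpha p u : R) :
  (forall x, 0 < F x) -> nonincreasing_fun F ->
  0 <= alpha -> regvar_tail F alpha -> alpha < p ->
  Gbar x / F x @[x --> +oo] --> (0 : R) ->
  exists h, truncation_level F Gbar p u h.
Proof.
move=> F_gt0 nF alpha0 rvF alphap GF.
have p0 : 0 <= p by exact: le_trans (ltW alphap).
have [c c0 [uc potter]] := pinfty_ex_gt0 (filterI (nbhs_pinfty_ge (num_real u))
  (potter_bound F_gt0 nF rvF p0 alphap)).
have hy : x / c @[x --> +oo] --> +oo.
  by apply: gt0_cvgMly; rewrite ?invr_gt0//; exact: cvg_id.
exists (fun x => x / c); split => //.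
- near=> x; have x0 : 0 <= x by near: x; exact: nbhs_pinfty_ge.
  by rewrite mulrA ler_pdivrMr// mulrC ler_wpM2l.
- rewrite -(mul0r (c `^ alpha)).
  apply: cvg_trans (cvgM (cvg_comp _ _ hy GF) (regvar_tail_div_cvg rvF c0)).
  apply: near_eq_cvg; apply: nearW => x /=.
  by rewrite -mulrA mulKf// gt_eqF.
- exists (2 `^ p); apply: nearW => x y /andP[y1 yx].
  by apply: potter => //; rewrite mulrC -ler_pdivlMr.
Unshelve. all: by end_near. Qed.

Lemma cvg0_near_mul_le {R : realType} (g : R -> R) (u : R) :
  (forall x, 0 <= x -> 0 < g x) -> g x @[x --> +oo] --> (0 : R) ->
  \forall x \near +oo, u * (x * g x) <= x.
Proof.
move=> g_gt0 g0; have u10 : 0 < (`|u| + 1)^-1 by rewrite invr_gt0 ltr_wpDl.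
apply: filterS2 (cvgr_lt _ g0 _ u10) (nbhs_pinfty_ge (num_real 0)) => x gu x0.
have gx := g_gt0 x x0.
rewrite mulrCA ler_piMr//; apply: (@le_trans _ _ ((`|u| + 1) * g x)).
  by rewrite ler_pM2r// (le_trans (ler_norm u))// lerDl.
by rewrite mulrC -ler_pdivlMr ?ltr_wpDl// div1r ltW.
Qed.

Lemma power_dominated_slowly_varying {R : realType} (F L h : R -> R)
    (alpha : R) :
  (forall x, 0 < x -> 0 < L x) ->
  F x / (x `^ (- alpha) * L x) @[x --> +oo] --> (1 : R) ->
  (forall u, \forall x \near +oo, u * h x <= x) ->
  (exists M, \forall x \near +oo, forall y, 1 <= y <= h x ->
     L (x / y) / L x <= M) ->
  power_dominated F alpha h.
Proof.
move=> L_gt0 FL uhx [M LM]; exists (4 * M).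
have xL_gt0 : \forall x \near +oo, 0 < x `^ (- alpha) * L x.
  apply: filterS (nbhs_pinfty_gt (num_real 0)) => x x0.
  by rewrite mulr_gt0 ?powR_gt0 ?L_gt0.
have [z z0 bounds] :=
  pinfty_ex_gt0 (near_pinfty_upward (cvg1_ratio_near_le FL xL_gt0)).
apply: filterS3 (uhx z) (nbhs_pinfty_ge (num_real z)) LM.
move=> x zhx zx LM y /[dup] /LM {}LM /andP[y1 yh].
have x0 : 0 < x by exact: lt_le_trans zx.
have y0 : 0 < y by exact: lt_le_trans y1.
have zxy : z <= x / y.
  by rewrite ler_pdivlMr// (le_trans _ zhx)// ler_pM2l.
have [Fxy _] := bounds _ zxy; have [_ Fx] := bounds _ zx.
have Lx := L_gt0 x x0; have Lxy : L (x / y) <= M * L x by rewrite -ler_pdivrMr.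
have M0 : 0 <= M.
  by apply: le_trans LM; rewrite divr_ge0// ltW// L_gt0// divr_gt0.
have powE : (x / y) `^ (- alpha) = x `^ (- alpha) * y `^ alpha.
  by rewrite powRM ?invr_ge0 ?powR_invN ?(ltW x0) ?(ltW y0).
have a0 := powR_ge0 x (- alpha); have b0 := powR_ge0 y alpha.
apply: (le_trans Fxy); rewrite powE.
apply: (@le_trans _ _ (2 * (x `^ (- alpha) * y `^ alpha * (M * L x)))).
  by rewrite ler_wpM2l// ler_wpM2l// mulr_ge0.
rewrite [leLHS](_ : _ = 2 * M * y `^ alpha * (x `^ (- alpha) * L x));
  last by ring.
rewrite [leRHS](_ : _ = 2 * M * y `^ alpha * (2 * F x)); last by ring.
by rewrite ler_wpM2l// !mulr_ge0.
Qed.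

Theorem theorem2p1 (R : realType) (d : measure_display) (T : measurableType d)
  (P : probability T R) (X Y : {RV P >-> R}) (s : R -> R) (alpha : R)
  (L : R -> R) :
  (forall x : R, 0 < tailP P X x) ->
  (forall w, 0 < Y w) ->
  CD P X Y s ->
  0 <= alpha ->
  regvar_tail (tailP P X) alpha ->
  (forall x : R, 0 < x -> 0 < L x) ->
  slowly_varying L ->
  tailP P X x / (x `^ (- alpha) * L x) @[x --> +oo] --> (1 : R) ->
  tailP P Y x / tailP P X x @[x --> +oo] --> (0 : R) ->
  ((exists eps : R, 0 < eps /\
      (\int[P]_w ((Y w `^ (alpha + eps) * s (Y w))%:E) < +oo)%E)
   \/
   (exists g : R -> R,
      (forall x, 0 <= x -> 0 < g x) /\
      {in `[0, +oo[ &, {homo g : a b /~ a <= b}} /\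
      g x @[x --> +oo] --> (0 : R) /\
      {in `[0, +oo[ &, {homo (fun x => x * g x) : a b / a <= b}} /\
      x * g x @[x --> +oo] --> +oo /\
      tailP P Y (x * g x) / tailP P X x @[x --> +oo] --> (0 : R) /\
      (exists M : R, exists x0 : R, forall x, x0 < x ->
         forall y, 1 <= y <= x * g x -> L (x / y) / L x <= M) /\
      (\int[P]_w ((Y w `^ alpha * s (Y w))%:E) < +oo)%E)) ->
  tailP P (fun w => X w * Y w) x /
    (fine (\int[P]_w ((Y w `^ alpha * s (Y w))%:E)) * tailP P X x)
    @[x --> +oo] --> (1 : R).
Proof.
move=> tailX_gt0 Y_gt0 CDXY alpha0 rvX L_gt0 _ FL tailYX moments.
rewrite -(weighted_moment_distributionE Y_gt0 CDXY).
suff [p [alphap Mp levels]] : exists p, [/\ alpha <= p,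
    (\int[P]_w (Y w `^ p * s (Y w))%:E < +oo)%E &
    forall u, exists h, truncation_level (tailP P X) (tailP P Y) p u h].
  rewrite -(weighted_moment_distributionE Y_gt0 CDXY) in Mp.
  exact: (product_tail_equiv Y_gt0 tailX_gt0 CDXY alpha0 rvX alphap Mp levels).
case: moments => [[eps [eps0 Meps]]|
    [g [g_gt0 [_ [g0 [_ [xgy [tailYg [[M [x0 LM]] Malpha]]]]]]]]].
- exists (alpha + eps); split=> // [|u]; first by rewrite lerDl ltW.
  apply: truncation_level_div alpha0 rvX _ tailYX => //; last by rewrite ltrDl.
  exact: tailP_nonincreasing.
- have ugx u := cvg0_near_mul_le u g_gt0 g0.
  exists alpha; split=> // u; exists (fun x => x * g x); split=> //.
  apply: (power_dominated_slowly_varying L_gt0 FL ugx).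
  by exists M, x0; split=> //; exact: num_real.
Qed.
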